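(* Let $W$ be a $3$-web with nonvanishing curvature given in a domain $D$, and let the invariant $$J=\det\begin{pmatrix}\nabla_1(a_1)&\nabla_1(a_2)\\ \nabla_2(a_1)&\nabla_2(a_2)\end{pmatrix}$$ be nonvanishing in $D$. Then $W$ is infinitesimally rigid in $D$.
   Context: $M$ is a two-dimensional smooth manifold and $D\subset M$ a domain. A $3$-web $W$ is given by three differential $1$-forms $\omega_1,\omega_2,\omega_3$, any two linearly independent at each point (the foliations of the web are $\{\omega_i=0\}$), normalized by $\omega_1+\omega_2+\omega_3=0$. There is a unique $1$-form $\gamma$ with $d\omega_1=\omega_1\wedge\gamma$, $d\omega_2=\omega_2\wedge\gamma$; the curvature $K$ is defined by $d\gamma=K\,\omega_1\wedge\omega_2$. It is assumed that $K$ is nowhere zero, and (changing the orientation if necessary) $K>0$, $K=k^2$ with $k>0$ smooth. Put $\theta_i=k\,\omega_i$ ($i=1,2$) and $\alpha=\gamma-dk/k$; then $d\theta_i=\theta_i\wedge\alpha$, $d\alpha=\theta_1\wedge\theta_2$. The vector fields $\nabla_1,\nabla_2$ form the basis dual to $\theta_1,\theta_2$, and the absolute invariants $a_1,a_2$ are the functions defined by $\alpha=a_1\theta_1+a_2\theta_2$. A vector field $X$ is an infinitesimal automorphism of $W$ if the (local) one-parameter group of shifts along $X$ consists of diffeomorphisms preserving $W$. The web $W$ is infinitesimally rigid if its only infinitesimal automorphism is $X=0$. *)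

(* Defs.v *)
From HB Require Import structures.
From mathcomp Require Import all_boot all_order all_algebra.
From mathcomp Require Import all_classical all_reals all_analysis.

Set Implicit Arguments.
Unset Strict Implicit.
Unset Printing Implicit Defensive.

Import Order.TTheory GRing.Theory Num.Theory.
Import numFieldNormedType.Exports.

Local Open Scope classical_set_scope.
Local Open Scope ring_scope.

(* C^n and C^oo maps on an open set U between (finite-dimensional) normed
   spaces; f is a total function whose values off U are irrelevant.  The
   definition is meant only for open U. *)
Section Smooth.
Context {R : realType} {V W : normedModType R}.

Fixpoint Ck (n : nat) (U : set V) (f : V -> W) : Prop :=
  match n with
  | 0 => forall x, U x -> {for x, continuous f}
  | m.+1 => (forall x, U x -> differentiable f x) /\
            (forall v : V, Ck m U ('D_v f))
  end.

Definition smooth (U : set V) (f : V -> W) : Prop := forall n, Ck n U f.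

End Smooth.

(* chart_inv c is a total function inverse to chart c between chart_dom c and
   chart_img c only.  The atlas is not required to be maximal. *)
Record smooth_surface (R : realType) := SmoothSurface {
  surface_carrier :> topologicalType;
  chart_index : Type;
  chart_dom : chart_index -> set surface_carrier;
  chart_img : chart_index -> set 'rV[R]_2;
  chart : chart_index -> surface_carrier -> 'rV[R]_2;
  chart_inv : chart_index -> 'rV[R]_2 -> surface_carrier;
  open_chart_dom : forall c, open (chart_dom c);
  open_chart_img : forall c, open (chart_img c);
  chart_in_img : forall c p, chart_dom c p -> chart_img c (chart c p);
  chart_inv_in_dom : forall c u, chart_img c u -> chart_dom c (chart_inv c u);
  chartK : forall c p, chart_dom c p -> chart_inv c (chart c p) = p;
  chart_invK : forall c u, chart_img c u -> chart c (chart_inv c u) = u;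
  chart_continuous : forall c p, chart_dom c p -> {for p, continuous (chart c)};
  chart_inv_continuous :
    forall c u, chart_img c u -> {for u, continuous (chart_inv c)};
  chart_cover : forall p, exists c, chart_dom c p;
  chart_transition : forall c c',
    smooth (chart_img c `&` chart_inv c @^-1` chart_dom c')
           (chart c' \o chart_inv c);
  surface_hausdorff : hausdorff_space surface_carrier;
  surface_second_countable : @second_countable surface_carrier
}.

Section Surface.
Context {R : realType} {M : smooth_surface R}.
Implicit Types (D U : set M) (c : chart_index M) (p : M) (f : M -> R).

Definition domain D : Prop := open D /\ connected D.

Definition smooth_function D f : Prop :=
  forall c, smooth (chart_img c `&` chart_inv c @^-1` D) (f \o chart_inv c).

Definition smooth_map D (F : M -> M) : Prop :=
  (forall p, D p -> {for p, continuous F}) /\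
  forall c c', smooth (chart_img c `&` chart_inv c @^-1` (D `&` F @^-1` chart_dom c'))
                      (chart c' \o F \o chart_inv c).

Definition diffeo_onto_open U (F : M -> M) : Prop :=
  [/\ open (F @` U), smooth_map U F &
      exists2 G, smooth_map (F @` U) G & forall p, U p -> G (F p) = p].

(* The tangent map of F at p, between the coordinates of the chart c at p and
   those of the chart c' at F p. *)
Definition tangent_map (F : M -> M) c c' p : 'rV[R]_2 -> 'rV[R]_2 :=
  'd (chart c' \o F \o chart_inv c) (chart c p).

(* Vector fields and 1-forms are represented by their components in every
   chart: X c p is the row of components of X at p in the chart c; it carries
   meaning only if p lies in the domain of c. *)
Definition components : Type := chart_index M -> M -> 'rV[R]_2.
Implicit Types (X w eta : components).

Definition smooth_components D X : Prop :=
  forall c, smooth (chart_img c `&` chart_inv c @^-1` D)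
                   (fun u => X c (chart_inv c u)).

Definition pairing (xi v : 'rV[R]_2) : R := \sum_(j < 2) xi 0 j * v 0 j.

Definition vector_field D X : Prop :=
  smooth_components D X /\
  forall c c' p, D p -> chart_dom c p -> chart_dom c' p ->
    X c' p = tangent_map id c c' p (X c p).

Definition one_form D w : Prop :=
  smooth_components D w /\
  forall c c' p v, D p -> chart_dom c p -> chart_dom c' p ->
    pairing (w c p) v = pairing (w c' p) (tangent_map id c c' p v).

Definition basis_vector (j : 'I_2) : 'rV[R]_2 := delta_mx 0 j.

Definition differential f : components := fun c p =>
  \row_j 'D_(basis_vector j) (f \o chart_inv c) (chart c p).

(* 2-forms are given by their coefficient of dx_0 /\ dx_1 in every chart. *)
Definition wedge_product w eta c p : R :=
  w c p 0 0 * eta c p 0 1 - w c p 0 1 * eta c p 0 0.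

Definition exterior_derivative w c p : R :=
  'D_(basis_vector 0) (fun u => w c (chart_inv c u) 0 1) (chart c p) -
  'D_(basis_vector 1) (fun u => w c (chart_inv c u) 0 0) (chart c p).

(* X(f) at p, computed in the chart c. *)
Definition vderive X f c p : R := 'D_(X c p) (f \o chart_inv c) (chart c p).

(* The forms omega_1, omega_2, omega_3 of the web are w 0, w 1, w 2. *)
Definition web3 D (w : 'I_3 -> components) : Prop :=
  [/\ forall i, one_form D (w i),
      forall i j c p, i != j -> D p -> chart_dom c p ->
        row_free (col_mx (w i c p) (w j c p)) &
      forall c p, D p -> chart_dom c p -> \sum_i w i c p = 0].

Definition web_connection D (w : 'I_3 -> components) (gamma : components) : Prop :=
  one_form D gamma /\
  forall c p, D p -> chart_dom c p ->
    exterior_derivative (w 0) c p = wedge_product (w 0) gamma c p /\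
    exterior_derivative (w 1) c p = wedge_product (w 1) gamma c p.

Definition web_curvature D (w : 'I_3 -> components) (gamma : components)
    (K : M -> R) : Prop :=
  forall c p, D p -> chart_dom c p ->
    exterior_derivative gamma c p = K p * wedge_product (w 0) (w 1) c p.

(* The coframe (omega_1, omega_2) up to orientation.  Interchanging omega_1
   and omega_2 (e = true) keeps gamma and replaces K by - K, so that
   (-1) ^+ e * K is the curvature with respect to the reoriented coframe. *)
Definition oriented_coframe (e : bool) (w : 'I_3 -> components) :
    'I_2 -> components :=
  fun i => if (i == 0) (+) e then w 0 else w 1.

Definition scaled_coframe (k : M -> R) (omega : 'I_2 -> components) :
    'I_2 -> components :=
  fun i c p => k p *: omega i c p.

Definition normalized_connection (k : M -> R) (gamma : components) : components :=
  fun c p => gamma c p - (k p)^-1 *: differential k c p.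

Definition dual_frame D (theta nabla : 'I_2 -> components) : Prop :=
  (forall i, vector_field D (nabla i)) /\
  forall c p i j, D p -> chart_dom c p ->
    pairing (theta i c p) (nabla j c p) = (i == j)%:R.

Definition absolute_invariants D (theta : 'I_2 -> components)
    (alpha : components) (a : 'I_2 -> M -> R) : Prop :=
  forall c p, D p -> chart_dom c p -> alpha c p = \sum_i a i p *: theta i c p.

Definition invariant_J (nabla : 'I_2 -> components) (a : 'I_2 -> M -> R) c p : R :=
  \det (\matrix_(i < 2, j < 2) vderive (nabla i) (a j) c p).

(* F maps the distribution {w = 0}, hence the foliation it defines, over U onto
   the same distribution over F @` U. *)
Definition preserves_foliation U w (F : M -> M) : Prop :=
  forall c c' p v, U p -> chart_dom c p -> chart_dom c' (F p) ->
    pairing (w c p) v = 0 <->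
    pairing (w c' (F p)) (tangent_map F c c' p v) = 0.

Definition preserves_web U (w : 'I_3 -> components) (F : M -> M) : Prop :=
  forall i, preserves_foliation U (w i) F.

(* Local one-parameter group of local transformations phi t : U -> M,
   |t| < eps, as in Kobayashi-Nomizu, Foundations of Differential Geometry I,
   section I.1. *)
Record local_one_parameter_group U (eps : R) (phi : R -> M -> M) : Prop := {
  flow_continuous : forall t p, `|t| < eps -> U p ->
    {for (t, p), continuous (fun z : R * M => phi z.1 z.2)};
  flow_smooth : forall c c',
    smooth [set z : R * 'rV[R]_2 |
             [/\ `|z.1| < eps, chart_img c z.2, U (chart_inv c z.2) &
                 chart_dom c' (phi z.1 (chart_inv c z.2))]]
           (fun z => chart c' (phi z.1 (chart_inv c z.2)));
  flow_diffeo : forall t, `|t| < eps -> diffeo_onto_open U (phi t);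
  flow0 : forall p, U p -> phi 0 p = p;
  flowD : forall s t p, `|s| < eps -> `|t| < eps -> `|s + t| < eps ->
    U p -> U (phi t p) -> phi (s + t) p = phi s (phi t p)
}.

Definition shifts_along D X U (eps : R) (phi : R -> M -> M) : Prop :=
  forall t p, `|t| < eps -> U p ->
    D (phi t p) /\
    forall c, chart_dom c (phi t p) ->
      is_derive t 1 (fun s => chart c (phi s p)) (X c (phi t p)).

(* The local one-parameter group of shifts along X exists near every point of
   D and is unique, whence the existential form. *)
Definition infinitesimal_automorphism D (w : 'I_3 -> components) X : Prop :=
  vector_field D X /\
  forall p0, D p0 -> exists (U : set M) (eps : R) (phi : R -> M -> M),
    [/\ open U, U p0, U `<=` D & 0 < eps] /\
    [/\ local_one_parameter_group U eps phi, shifts_along D X U eps phi &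
        forall t, `|t| < eps -> preserves_web U w (phi t)].

Definition zero_on D X : Prop :=
  forall c p, D p -> chart_dom c p -> X c p = 0.

Definition infinitesimally_rigid D (w : 'I_3 -> components) : Prop :=
  forall X, vector_field D X ->
    infinitesimal_automorphism D w X <-> zero_on D X.

End Surface.

Arguments components {R} M.

(* Main.v *)
Require Import Defs.
From HB Require Import structures.
From mathcomp Require Import all_boot all_order all_algebra.
From mathcomp Require Import all_classical all_reals all_analysis.
From mathcomp Require Import ring.

Set Implicit Arguments.
Unset Strict Implicit.
Unset Printing Implicit Defensive.

Import Order.TTheory GRing.Theory Num.Theory.
Import numFieldNormedType.Exports.

Local Open Scope classical_set_scope.
Local Open Scope ring_scope.

(** The idea is that an infinitesimal automorphism of the web must preserve
the normalized coframe itself, hence every function built invariantly from it;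
when J does not vanish the two invariants a_0, a_1 are local coordinates, and
a field that annihilates both of them is zero.

In detail, let X be an infinitesimal automorphism.  Its flow preserves each
foliation {w_i = 0}, so the Lie derivative L_X w_i is proportional to w_i
([flow_lie_derivative], [automorphism_lie_derivative]).  Because
w_0 + w_1 + w_2 = 0 and w_0, w_1 are independent, the three factors agree
([web_lie_derivative]), so that L_X theta_i = h theta_i with one function h for
both forms of the rescaled coframe theta_i.

It remains to see that h = 0, and this is where the curvature enters, through
d theta_i = theta_i /\ alpha and d alpha = theta_0 /\ theta_1.  Put
x_i = theta_i(X) and m = h + alpha(X).  Cartan's formula turns
L_X theta_i = h theta_i into d x_i = m theta_i - x_i alpha.  Exterior
differentiation of these two equations gives d m = x_1 theta_0 - x_0 theta_1,
and differentiating once more gives m = alpha(X), i.e. h = 0.  As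
alpha = a_0 theta_0 + a_1 theta_1, this says m = a_0 x_0 + a_1 x_1; comparing
the differentials of the two sides, and using d alpha = theta_0 /\ theta_1
again, one finds X(a_0) = X(a_1) = 0 ([symmetry_fixes_invariants]).

The only analytic ingredient is the symmetry of second derivatives
([derive_comm]).  It is used in the plane, where it says that exact forms are
closed, and on the product of the time axis with the plane, where it exchanges
the time derivative of the flow with its space derivative.

Conversely the zero field is an infinitesimal automorphism, since its flow is
constant ([zero_infinitesimal_automorphism]). *)

(** * Algebra in dimension two *)

Section PlaneAlgebra.

Lemma ord2_ind (P : 'I_2 -> Prop) : P 0 -> P 1 -> forall i, P i.
Proof.
move=> P0 P1 [[|[|//]] lt2].
  by rewrite (_ : Ordinal lt2 = 0)//; exact: val_inj.
by rewrite (_ : Ordinal lt2 = 1)//; exact: val_inj.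
Qed.

Lemma sum_ord2 (V : nmodType) (f : 'I_2 -> V) : \sum_(i < 2) f i = f 0 + f 1.
Proof. by rewrite big_ord_recl big_ord1; congr (_ + f _); exact: val_inj. Qed.

Lemma det_plane (F : comRingType) (A : 'M[F]_2) :
  \det A = A 0 0 * A 1 1 - A 0 1 * A 1 0.
Proof.
rewrite (expand_det_row _ 0) sum_ord2 /cofactor !det_mx11 !mxE /=.
rewrite expr0 expr1 mul1r mulN1r mulrN.
by congr (A _ _ * A _ _ - A _ _ * A _ _); exact: val_inj.
Qed.

(** The area of a coframe times the area of its dual frame is the determinant
of the identity. *)
Lemma dual_frame_area (F : fieldType) (th nb : 'I_2 -> 'I_2 -> F) :
  (forall i j, th i 0 * nb j 0 + th i 1 * nb j 1 = (i == j)%:R) ->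
  th 0 0 * th 1 1 - th 0 1 * th 1 0 != 0.
Proof.
move=> dual; apply/eqP => area0.
have E : (th 0 0 * th 1 1 - th 0 1 * th 1 0) *
         (nb 0 0 * nb 1 1 - nb 0 1 * nb 1 0) = 1.
  transitivity ((th 0 0 * nb 0 0 + th 0 1 * nb 0 1) *
      (th 1 0 * nb 1 0 + th 1 1 * nb 1 1) -
    (th 0 0 * nb 1 0 + th 0 1 * nb 1 1) *
      (th 1 0 * nb 0 0 + th 1 1 * nb 0 1)); first by ring.
  by rewrite !dual !eqxx /= mulr1 mul0r subr0.
by move/eqP: E; rewrite area0 mul0r eq_sym oner_eq0.
Qed.

(** A linear map of the plane with three distinct invariant lines is a scalar;
here the map sends p, q and p + q to L, N and L + N. *)
Lemma common_factor (F : fieldType) (p q L N : 'I_2 -> F) :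
  p 0 * q 1 - p 1 * q 0 != 0 ->
  p 0 * L 1 - p 1 * L 0 = 0 -> q 0 * N 1 - q 1 * N 0 = 0 ->
  (p 0 + q 0) * (L 1 + N 1) - (p 1 + q 1) * (L 0 + N 0) = 0 ->
  exists g, forall l, L l = g * p l /\ N l = g * q l.
Proof.
move=> d0 pL qN pqLN; set d := _ - _ in d0.
have LqpN : L 0 * q 1 - L 1 * q 0 = p 0 * N 1 - p 1 * N 0.
  apply/eqP; rewrite -subr_eq0; apply/eqP.
  transitivity ((p 0 * L 1 - p 1 * L 0) + (q 0 * N 1 - q 1 * N 0) -
    ((p 0 + q 0) * (L 1 + N 1) - (p 1 + q 1) * (L 0 + N 0))); first by ring.
  by rewrite pL qN pqLN subr0 addr0.
(* Cramer's rule in the basis p, q *)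
have LE l : L l * d =
    (L 0 * q 1 - L 1 * q 0) * p l + (p 0 * L 1 - p 1 * L 0) * q l.
  by rewrite /d; elim/ord2_ind: l; ring.
have NE l : N l * d =
    (p 0 * N 1 - p 1 * N 0) * q l - (q 0 * N 1 - q 1 * N 0) * p l.
  by rewrite /d; elim/ord2_ind: l; ring.
exists ((L 0 * q 1 - L 1 * q 0) / d) => l.
split; apply: (mulIf d0); first by rewrite LE pL; field.
by rewrite NE qN -LqpN; field.
Qed.

Lemma oriented_area (F : comRingType) (e : bool) (k : F) (p q : 'I_2 -> F) :
  let o (i : 'I_2) := if (i == 0) (+) e then p else q in
  (k * o 0 0) * (k * o 1 1) - (k * o 0 1) * (k * o 1 0) =
  k ^+ 2 * ((-1) ^+ e * (p 0 * q 1 - p 1 * q 0)).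
Proof. by case: e => /=; rewrite ?expr1 ?expr0; ring. Qed.

(** Here n is the matrix of a frame, p that of the partial derivatives of two
functions; the determinant of their product is the invariant J. *)
Lemma kernel_of_regular_product (F : fieldType)
    (n00 n01 n10 n11 p00 p01 p10 p11 X0 X1 : F) :
  (n00 * p00 + n01 * p10) * (n10 * p01 + n11 * p11) -
  (n00 * p01 + n01 * p11) * (n10 * p00 + n11 * p10) != 0 ->
  X0 * p00 + X1 * p10 = 0 -> X0 * p01 + X1 * p11 = 0 -> X0 = 0 /\ X1 = 0.
Proof.
have -> : (n00 * p00 + n01 * p10) * (n10 * p01 + n11 * p11) -
  (n00 * p01 + n01 * p11) * (n10 * p00 + n11 * p10) =
  (n00 * n11 - n01 * n10) * (p00 * p11 - p01 * p10) by ring.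
rewrite mulf_eq0 negb_or => /andP[_ d0] E0 E1.
split; apply: (mulIf d0); rewrite mul0r.
  transitivity ((X0 * p00 + X1 * p10) * p11 - (X0 * p01 + X1 * p11) * p10).
    by ring.
  by rewrite E0 E1 !mul0r subrr.
transitivity ((X0 * p01 + X1 * p11) * p00 - (X0 * p00 + X1 * p10) * p01).
  by ring.
by rewrite E0 E1 !mul0r subrr.
Qed.

End PlaneAlgebra.

(** * Second derivatives commute *)

Section SecondDerivatives.
Context {R : realType}.

Section Germs.
Context {V W : normedModType R}.

Lemma differentiableP_norm (f : V -> W) (x : V) (e : R) :
  differentiable f x -> 0 < e ->
  \forall h \near 0, `|f (h + x) - f x - 'd f x h| <= e * `|h|.
Proof.
move=> /diff_locally /eqaddoP fx e0; have := fx e e0.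
by apply: filterS => h; rewrite /= opprD addrA.
Qed.

Lemma near_eq_differentiable (f g : V -> W) (x : V) :
  {near x, f =1 g} -> differentiable f x -> differentiable g x.
Proof.
move=> fg df.
have fgx : f x = g x by exact: (nbhs_singleton fg).
have dg : g \o shift x = cst (g x) + 'd f x +o_ 0 id.
  apply/eqaddoP => e e0; near=> h.
  have -> : (g \o shift x - (cst (g x) + 'd f x)) h =
            f (h + x) - f x - 'd f x h.
    have fgh : f (h + x) = g (h + x).
      by near: h; move: fg; rewrite (near_shift 0) subr0.
    by rewrite /= fgh fgx opprD addrA.
  by near: h; exact: differentiableP_norm.
apply/diff_locallyP.
have -> : 'd g x = 'd f x :> (V -> W).
  by apply: diff_unique => //; exact: diff_continuous.
by split=> //; exact: diff_continuous.
Unshelve. all: by end_near. Qed.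

End Germs.

Section Young.
Context {V : normedModType R}.
Implicit Types (f : V -> R) (x v w : V).

Lemma is_derive_line f x v (s : R) :
  differentiable f (s *: v + x) ->
  is_derive s 1 (fun s : R => f (s *: v + x)) ('D_v f (s *: v + x)).
Proof.
move=> df.
have dl : is_diff s (fun s : R => s *: v + x) (fun s : R => s *: v).
  apply: is_diff_eq; rewrite ?addr0//.
have dc : differentiable (f \o (fun s : R => s *: v + x)) s.
  by apply: differentiable_comp.
apply: DeriveDef; first exact: diff_derivable.
rewrite -/(f \o (fun s : R => s *: v + x)) deriveE// diff_comp//= diff_val.
by rewrite scale1r -deriveE.
Qed.

(** The second difference of f over the parallelogram spanned by t v and t w
is t^2 times the derivative along w of the derivative along v, up to o(t^2):
the mean value theorem along v expresses it through a first difference of the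
derivative along v, to which the definition of the differential applies. *)
Lemma second_difference f x v w (e : R) :
  (\forall y \near x, differentiable f y) ->
  differentiable ('D_v f) x -> 0 < e ->
  \forall t \near 0^'+,
    `|f (t *: v + (t *: w + x)) - f (t *: v + x) - f (t *: w + x) + f x
      - t * (t * 'D_w ('D_v f) x)| <= t * (t * e).
Proof.
move=> df dg e0; set g := 'D_v f; set c := `|v| + `|w| + 1.
have c0 : 0 < c by rewrite /c ltr_wpDl// addr_ge0.
have e'0 : 0 < e / (2 * c) by rewrite divr_gt0// mulr_gt0.
have dfx : \forall h \near (0 : V), differentiable f (h + x).
  by move: df; rewrite (near_shift 0) subr0.
have dgx := differentiableP_norm dg e'0.
have [r /= r0 Hr] : exists2 r, 0 < r & forall h : V, `|h| < r ->
    differentiable f (h + x) /\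
    `|g (h + x) - g x - 'd g x h| <= e / (2 * c) * `|h|.
  have : \forall h \near (0 : V), differentiable f (h + x) /\
      `|g (h + x) - g x - 'd g x h| <= e / (2 * c) * `|h|.
    exact: filterI dfx dgx.
  case/nbhs_ballP => r r0 Hr; exists r => // h hr; apply: Hr.
  by rewrite -ball_normE /= sub0r normrN.
have small t s : 0 < t -> t < r / c -> 0 <= s <= t ->
    `|s *: v + t *: w| <= t * c /\ `|s *: v| <= t * c.
  move=> t0 tr /andP[s0 st].
  have sv : `|s *: v| <= t * `|v| by rewrite normrZ ger0_norm// ler_wpM2r.
  split; last first.
    by rewrite (le_trans sv)// (ler_wpM2l (ltW t0))// /c -addrA lerDl addr_ge0.
  rewrite (le_trans (ler_normD _ _))// /c !mulrDr -addrA lerD//.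
  by rewrite normrZ (gtr0_norm t0) lerDl mulr1 ltW.
have inr t h : t < r / c -> `|h| <= t * c ->
    differentiable f (h + x) /\
    `|g (h + x) - g x - 'd g x h| <= e / (2 * c) * `|h|.
  move=> tr hc; apply: Hr; rewrite (le_lt_trans hc)//.
  by rewrite -ltr_pdivlMr.
have : \forall t \near 0^'+, 0 < t /\ t < r / c.
  apply: filterI; first exact: nbhs_right_gt.
  by apply: nbhs_right_lt; rewrite divr_gt0.
apply: filterS => t [t0 tr].
have incl (s : R) : 0 <= s <= t ->
    differentiable f (s *: v + (t *: w + x)) /\ differentiable f (s *: v + x).
  move=> st; have [n1 n2] := small _ _ t0 tr st.
  by rewrite addrA; split; [have [] := inr _ _ tr n1|have [] := inr _ _ tr n2].
pose G (s : R) := f (s *: v + (t *: w + x)) - f (s *: v + x).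
pose dG (s : R) := g (s *: v + (t *: w + x)) - g (s *: v + x).
have GdG s : 0 <= s <= t -> is_derive s 1 G (dG s).
  by move=> /incl[d1 d2]; apply: is_deriveB; exact: is_derive_line.
(* G t - G 0 is the second difference *)
have [//| | |xi] := @MVT R G dG 0 t.
- by move=> s; rewrite in_itv/= => /andP[s0 st]; apply: GdG; rewrite !ltW.
- by apply: derivable_within_continuous => s; rewrite in_itv/= => /GdG[].
rewrite in_itv/= => /andP[xi0 xit] Gt.
have xi0t : 0 <= xi <= t by rewrite !ltW.
have [n1 n2] := small _ _ t0 tr xi0t.
have [_ b1] := inr _ _ tr n1; have [_ b2] := inr _ _ tr n2.
have -> : f (t *: v + (t *: w + x)) - f (t *: v + x) - f (t *: w + x) + f x =
    G t - G 0.
  by rewrite /G !scale0r !add0r; ring.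
have -> : 'D_w g x = 'd g x w by exact: deriveE.
rewrite Gt subr0 mulrC -mulrBr normrM (gtr0_norm t0) (ler_wpM2l (ltW t0))//.
have -> : dG xi - t * 'd g x w =
   (g (xi *: v + t *: w + x) - g x - 'd g x (xi *: v + t *: w)) -
   (g (xi *: v + x) - g x - 'd g x (xi *: v)).
  have -> : 'd g x (xi *: v + t *: w) = 'd g x (xi *: v) + t * 'd g x w.
    by rewrite linearD; congr (_ + _); exact: linearZ.
  by rewrite /dG addrA; ring.
have ec : e / (2 * c) * (t * c) + e / (2 * c) * (t * c) = t * e.
  by field; rewrite gt_eqF.
rewrite -ec (le_trans (ler_normB _ _))// lerD//.
  by rewrite (le_trans b1)// ler_wpM2l// ltW.
by rewrite (le_trans b2)// ler_wpM2l// ltW.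
Qed.

Let dist_le_of_common_approximation (t e d A B : R) : 0 < t ->
  `|d - t * (t * A)| <= t * (t * (e / 2)) ->
  `|d - t * (t * B)| <= t * (t * (e / 2)) -> `|A - B| <= e.
Proof.
move=> t0 dA dB; rewrite -(ler_pM2l t0) -(ler_pM2l t0).
have -> : t * (t * `|A - B|) = `|t * (t * (A - B))|.
  by rewrite !normrM (gtr0_norm t0).
have -> : t * (t * (A - B)) = (d - t * (t * B)) - (d - t * (t * A)) by ring.
have -> : t * (t * e) = t * (t * (e / 2)) + t * (t * (e / 2)) by field.
exact: le_trans (ler_normB _ _) (lerD dB dA).
Qed.

(** Young's theorem: the second difference is symmetric in v and w, and it
determines both mixed derivatives in the limit.  Differentiability of the first
derivatives is the form of the hypothesis that can be read off when these
derivatives are given by explicit formulas. *)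
Lemma derive_comm f x v w :
  (\forall y \near x, differentiable f y) ->
  differentiable ('D_v f) x -> differentiable ('D_w f) x ->
  'D_w ('D_v f) x = 'D_v ('D_w f) x.
Proof.
move=> df dv dw; apply/eqP; rewrite -subr_eq0 -normr_le0.
apply/ler_addgt0Pl => e e0; rewrite addr0.
have e20 : 0 < e / 2 by rewrite divr_gt0.
have [t [[t0 Hv] Hw]] := filter_ex (filterI (filterI (nbhs_right_gt (0 : R))
  (second_difference w df dv e20)) (second_difference v df dw e20)).
apply: dist_le_of_common_approximation t0 Hv _.
by move: Hw; rewrite addrCA (addrAC (f _)).
Qed.

End Young.
End SecondDerivatives.

(** * Calculus of coordinate functions on the plane *)

Section PlaneCalculus.
Context {R : realType}.
Implicit Types (f g : 'rV[R]_2 -> R) (u : 'rV[R]_2) (O : set 'rV[R]_2).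

Definition partial (j : 'I_2) f : 'rV[R]_2 -> R := 'D_(basis_vector j) f.

Definition differentiable_on O f : Prop := forall u, O u -> differentiable f u.

Lemma partialM j f g u : differentiable f u -> differentiable g u ->
  partial j (fun x => f x * g x) u = f u * partial j g u + g u * partial j f u.
Proof.
by move=> df dg; exact: (deriveM (diff_derivable df) (diff_derivable dg)).
Qed.

Lemma partialD j f g u : differentiable f u -> differentiable g u ->
  partial j (fun x => f x + g x) u = partial j f u + partial j g u.
Proof.
by move=> df dg; exact: (deriveD (diff_derivable df) (diff_derivable dg)).
Qed.

Lemma partialN j f u : differentiable f u ->
  partial j (fun x => - f x) u = - partial j f u.
Proof. by move=> df; exact: (deriveN (diff_derivable df)). Qed.

Lemma partialB j f g u : differentiable f u -> differentiable g u ->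
  partial j (fun x => f x - g x) u = partial j f u - partial j g u.
Proof.
by move=> df dg; exact: (deriveB (diff_derivable df) (diff_derivable dg)).
Qed.

Lemma partialV j f u : f u != 0 -> differentiable f u ->
  partial j (fun x => (f x)^-1) u = - (f u) ^- 2 * partial j f u.
Proof. by move=> fu df; exact: (deriveV fu (diff_derivable df)). Qed.

Lemma differentiable_onD O f g :
  differentiable_on O f -> differentiable_on O g ->
  differentiable_on O (fun x => f x + g x).
Proof. by move=> df dg u Ou; exact: differentiableD (df u Ou) (dg u Ou). Qed.

Lemma differentiable_onB O f g :
  differentiable_on O f -> differentiable_on O g ->
  differentiable_on O (fun x => f x - g x).
Proof. by move=> df dg u Ou; exact: differentiableB (df u Ou) (dg u Ou). Qed.

Lemma differentiable_onM O f g :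
  differentiable_on O f -> differentiable_on O g ->
  differentiable_on O (fun x => f x * g x).
Proof. by move=> df dg u Ou; exact: differentiableM (df u Ou) (dg u Ou). Qed.

Lemma differentiable_onV O f : (forall u, O u -> f u != 0) ->
  differentiable_on O f -> differentiable_on O (fun x => (f x)^-1).
Proof. by move=> f0 df u Ou; exact: differentiableV (df u Ou) (f0 u Ou). Qed.

Lemma derive_partials f u v : differentiable f u ->
  'D_v f u = v 0 0 * partial 0 f u + v 0 1 * partial 1 f u.
Proof.
move=> df; rewrite /partial !deriveE//.
have {1}-> : v = v 0 0 *: basis_vector 0 + v 0 1 *: basis_vector 1.
  apply/rowP => j; rewrite !mxE; elim/ord2_ind: j => /=.
    by rewrite mulr1 mulr0 addr0.
  by rewrite mulr1 mulr0 add0r.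
by rewrite linearD; congr (_ + _); exact: linearZ.
Qed.

Section OpenSet.
Context (O : set 'rV[R]_2) (openO : open O).

Lemma partial_eq_on j f g : (forall u, O u -> f u = g u) ->
  forall u, O u -> partial j f u = partial j g u.
Proof.
move=> fg u Ou; apply: near_eq_derive.
by apply: filterS (open_nbhs_nbhs (conj openO Ou)) => x; exact: fg.
Qed.

Lemma differentiable_on_eq f g : (forall u, O u -> f u = g u) ->
  differentiable_on O f -> differentiable_on O g.
Proof.
move=> fg df u Ou; apply: near_eq_differentiable (df u Ou).
by apply: filterS (open_nbhs_nbhs (conj openO Ou)) => x; exact: fg.
Qed.

(** This is d (d f) = 0.  The F j are the formulas for the partial derivatives
of f that the equations satisfied by f provide; that they are differentiable is
what makes the exterior differentiation of these equations legitimate. *)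
Lemma closed_differential f (F : 'I_2 -> 'rV[R]_2 -> R) :
  differentiable_on O f -> (forall j, differentiable_on O (F j)) ->
  (forall j u, O u -> partial j f u = F j u) ->
  forall u, O u -> partial 0 (F 1) u = partial 1 (F 0) u.
Proof.
move=> df dF fF u Ou.
have dpf j : differentiable (partial j f) u.
  by apply: (differentiable_on_eq _ (dF j)) Ou => x /(fF j x) ->.
rewrite -(partial_eq_on 0 (fF 1) Ou) -(partial_eq_on 1 (fF 0) Ou).
apply: derive_comm; rewrite /=; [|exact: dpf|exact: dpf].
by apply: filterS (open_nbhs_nbhs (conj openO Ou)) => x; exact: df.
Qed.

End OpenSet.
End PlaneCalculus.

(** Differentiability of polynomial expressions in differentiable functions. *)
Ltac differentiate :=
  repeat first [ assumption | apply: differentiable_onB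
               | apply: differentiable_onD | apply: differentiable_onM ].

(** Values at u are made into variables first: comparing the terms as they
stand would unfold the derivatives. *)
Ltac abstract_values u :=
  repeat match goal with |- context [?f u] => generalize (f u); intro end.

Ltac ring_at u := abstract_values u; ring.

(** * Smooth maps and their coordinates *)

Section SmoothMaps.
Context {R : realType}.

Section Generic.
Context {V W : normedModType R}.
Implicit Types (U : set V) (f g : V -> W).

Lemma smooth_differentiable U f x : smooth U f -> U x -> differentiable f x.
Proof. by move=> sf Ux; have [df _] := sf 1%N; exact: df. Qed.

Lemma smooth_derive U f v : smooth U f -> smooth U ('D_v f).
Proof. by move=> sf n; have [_] := sf n.+1; apply. Qed.

Lemma Ck_subset n U U' f : U' `<=` U -> Ck n U f -> Ck n U' f.
Proof.
move=> sub; elim: n f => [|n IHn] f /=; first by move=> cf x /sub; exact: cf.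
by move=> [df Df]; split=> [x /sub|v]; [exact: df|exact: IHn].
Qed.

Lemma smooth_subset U U' f : U' `<=` U -> smooth U f -> smooth U' f.
Proof. by move=> sub sf n; exact: Ck_subset sub (sf n). Qed.

End Generic.

Lemma differentiable_entry {V : normedModType R} {n} (f : V -> 'rV[R]_n) x j :
  differentiable f x -> differentiable (fun z => f z 0 j) x.
Proof.
move=> df.
apply: (@differentiable_comp _ _ _ _ f (fun N : 'rV[R]_n => N 0 j)) => //.
exact: differentiable_coord.
Qed.

Lemma derive_entry {V : normedModType R} {n} (f : V -> 'rV[R]_n) x v j :
  differentiable f x -> 'D_v (fun z => f z 0 j) x = ('D_v f x) 0 j.
Proof. by move=> df; rewrite (derive_mx (diff_derivable df)) mxE. Qed.

Lemma differentiable_derive_entry {V : normedModType R} {n}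
    (f : V -> 'rV[R]_n) x v j :
  (\forall y \near x, differentiable f y) -> differentiable ('D_v f) x ->
  differentiable ('D_v (fun z => f z 0 j)) x.
Proof.
move=> df dDf; apply: near_eq_differentiable (differentiable_entry j dDf).
by apply: filterS df => y dfy; rewrite /= derive_entry.
Qed.

Lemma differentiable_snd {V W : normedModType R} (z : V * W) :
  differentiable snd z.
Proof.
apply: (@linear_differentiable _ _ _ (snd : {linear (V * W)%type -> W})) => ?.
exact: cvg_snd.
Qed.

(** The derivative of f o snd along v is convertible to ('D_(v.2) f) o snd, so
that the induction hypothesis applies as it is. *)
Lemma Ck_comp_snd {V W W' : normedModType R} n
    (U : set (V * W)) (U' : set W) (f : W -> W') :
  (forall z, U z -> U' z.2) -> Ck n U' f -> Ck n U (fun z => f z.2).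
Proof.
move=> UU'; elim: n f => [|n IHn] f /=.
  move=> cf z Uz; apply: (@continuous_comp _ _ _ snd f); first exact: cvg_snd.
  by apply: cf; exact: UU'.
move=> [df Df]; split=> [z Uz|v]; last exact: IHn (Df v.2).
apply: (@differentiable_comp _ _ _ _ snd f); first exact: differentiable_snd.
by apply: df; exact: UU'.
Qed.

Section Slices.
Context {V W W' : normedModType R} (f : V * W -> W').

Lemma derive_slice_snd x y v : 'D_(0, v) f (x, y) = 'D_v (fun y => f (x, y)) y.
Proof.
rewrite /derive; set g1 := fun h => _; set g2 := fun h => _.
suff -> : g1 = g2 by []; apply/funext => h; rewrite /g1 /g2.
by rewrite /= -[h *: _ + _]/(h *: 0 + x, h *: v + y) scaler0 add0r.
Qed.

Lemma derive_slice_fst x y v : 'D_(v, 0) f (x, y) = 'D_v (fun x => f (x, y)) x.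
Proof.
rewrite /derive; set g1 := fun h => _; set g2 := fun h => _.
suff -> : g1 = g2 by []; apply/funext => h; rewrite /g1 /g2.
by rewrite /= -[h *: _ + _]/(h *: v + x, h *: 0 + y) scaler0 add0r.
Qed.

Lemma differentiable_slice_snd x y : differentiable f (x, y) ->
  differentiable (fun y => f (x, y)) y.
Proof.
by move=> df; apply: (@differentiable_comp _ _ _ _ (fun y => (x, y)) f).
Qed.

End Slices.

End SmoothMaps.

Section Charts.
Context {R : realType} {M : smooth_surface R}.
Implicit Types (D : set M) (c : chart_index M) (p : M).

Definition coordinate_set c D : set 'rV[R]_2 :=
  chart_img c `&` chart_inv c @^-1` D.

Lemma open_coordinate_set c D : open D -> open (coordinate_set c D).
Proof.
move=> oD; rewrite openE => u [cu Du].
have n1 : nbhs u (chart_img c).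
  exact: open_nbhs_nbhs (conj (@open_chart_img _ _ c) cu).
have n2 : nbhs (chart_inv c u) D by exact: open_nbhs_nbhs (conj oD Du).
exact: filterI n1 (chart_inv_continuous cu n2).
Qed.

Lemma chart_coordinate_set c D p :
  chart_dom c p -> D p -> coordinate_set c D (chart c p).
Proof. by move=> cp Dp; split; [exact: chart_in_img|rewrite /= chartK]. Qed.

Section Components.
Context (D : set M) (openD : open D) (c : chart_index M).

Definition coordinate (X : components M) (l : 'I_2) (u : 'rV[R]_2) : R :=
  X c (chart_inv c u) 0 l.

Lemma coordinate_differentiable X l : smooth_components D X ->
  differentiable_on (coordinate_set c D) (coordinate X l).
Proof.
move=> sX u Ou.
apply: (differentiable_entry (f := fun u => X c (chart_inv c u))).
exact: smooth_differentiable (sX c) Ou.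
Qed.

Lemma coordinate_differentiable2 X l j : smooth_components D X ->
  differentiable_on (coordinate_set c D) (partial j (coordinate X l)).
Proof.
move=> sX u Ou.
apply: (differentiable_derive_entry (f := fun u => X c (chart_inv c u))).
  apply: filterS (open_nbhs_nbhs (conj (open_coordinate_set openD) Ou)) => y.
  exact: smooth_differentiable (sX c).
exact: smooth_differentiable (smooth_derive _ (sX c)) Ou.
Qed.

Definition lie_derivative (X w : components M) (l : 'I_2) (u : 'rV[R]_2) : R :=
  coordinate X 0 u * partial 0 (coordinate w l) u +
  coordinate X 1 u * partial 1 (coordinate w l) u +
  (coordinate w 0 u * partial l (coordinate X 0) u +
   coordinate w 1 u * partial l (coordinate X 1) u).

End Components.

End Charts.

(** * The Lie derivative of a preserved foliation *)

Section FlowLieDerivative.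
Context {R : realType} {M : smooth_surface R}.
Context (D U : set M) (w X : components M) (eps : R) (phi : R -> M -> M).
Context (openU : open U) (UD : U `<=` D) (eps_gt0 : 0 < eps).
Context (w_smooth : smooth_components D w).
Context (phi_group : local_one_parameter_group U eps phi)
  (phi_shifts : shifts_along D X U eps phi)
  (phi_preserves : forall t, `|t| < eps -> preserves_foliation U w (phi t)).
Context (c : chart_index M) (p : M) (Up : U p) (cp : chart_dom c p).

Let u : 'rV[R]_2 := chart c p.

(** The flow in coordinates, as one function of time and place. *)
Let F (z : R * 'rV[R]_2) : 'rV[R]_2 := chart c (phi z.1 (chart_inv c z.2)).

Let S : set (R * 'rV[R]_2) :=
  [set z | [/\ `|z.1| < eps, chart_img c z.2, U (chart_inv c z.2) &
               chart_dom c (phi z.1 (chart_inv c z.2))]].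

Let F_smooth : smooth S F.
Proof. exact: (flow_smooth phi_group). Qed.

Let near_S : \forall z \near ((0 : R), u), S z.
Proof.
have [cu Uu] := chart_coordinate_set cp Up.
have n1 : \forall z \near ((0 : R), u), `|z.1| < eps.
  have : fst @ ((0 : R), u) --> (0 : R) by exact: cvg_fst.
  by move/(_ [set t | `|t| < eps]); apply; exact: (@nbhs0_lt R R).
have n2 : \forall z \near ((0 : R), u), coordinate_set c U z.2.
  have : snd @ ((0 : R), u) --> u by exact: cvg_snd.
  move/(_ (coordinate_set c U)); apply; apply: open_nbhs_nbhs.
  by split; [exact: open_coordinate_set|split].
have n3 : \forall z \near ((0 : R), u), chart_dom c (phi z.1 (chart_inv c z.2)).
  have c1 : (fun z : R * 'rV[R]_2 => (z.1, chart_inv c z.2)) @ ((0 : R), u) -->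
      ((0 : R), p).
    have c3 : chart_inv c @ u --> p.
      by rewrite -[X in _ --> X](chartK cp); exact: chart_inv_continuous.
    have c4 : (fun z : R * 'rV[R]_2 => chart_inv c z.2) @ ((0 : R), u) --> p.
      by exact: cvg_comp cvg_snd c3.
    have c5 : (fun z : R * 'rV[R]_2 => z.1) @ ((0 : R), u) --> (0 : R).
      exact: cvg_fst.
    exact: (cvg_pair c5 c4).
  have c2 : (fun z : R * M => phi z.1 z.2) @ ((0 : R), p) --> p.
    rewrite -[X in _ --> X](flow0 phi_group Up).
    by apply: (flow_continuous phi_group) => //; rewrite normr0.
  apply: (cvg_comp _ _ c1 c2 (chart_dom c)).
  exact: open_nbhs_nbhs (conj (@open_chart_dom _ _ c) cp).
by apply: filterS3 n1 n2 n3 => z ? [].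
Qed.

Let F_diff : \forall z \near ((0 : R), u), differentiable F z.
Proof. by apply: filterS near_S => z; exact: smooth_differentiable. Qed.

Let F_diff2 v : differentiable ('D_v F) ((0 : R), u).
Proof.
exact: smooth_differentiable (smooth_derive v F_smooth) (nbhs_singleton near_S).
Qed.

Let near_u : \forall y \near u, S (0, y).
Proof.
have : (fun y : 'rV[R]_2 => ((0 : R), y)) @ u --> ((0 : R), u).
  have c1 : (fun _ : 'rV[R]_2 => (0 : R)) @ u --> (0 : R).
    by apply: cvg_cst; exact: nbhs_filter.
  have c2 : (fun y : 'rV[R]_2 => y) @ u --> u by exact: cvg_id.
  exact: (cvg_pair c1 c2).
by move/(_ S); apply; exact: near_S.
Qed.

Let near_0 : \forall t \near (0 : R), S (t, u).
Proof.
have : (fun t : R => (t, u)) @ (0 : R) --> ((0 : R), u).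
  have c1 : (fun t : R => t) @ (0 : R) --> (0 : R) by exact: cvg_id.
  have c2 : (fun _ : R => u) @ (0 : R) --> u.
    by apply: cvg_cst; exact: nbhs_filter.
  exact: (cvg_pair c1 c2).
by move/(_ S); apply; exact: near_S.
Qed.

Let F0 y : S (0, y) -> F (0, y) = y.
Proof. by case=> _ /= cy Uy _; rewrite /F/= (flow0 phi_group)// chart_invK. Qed.

Let velocity y : S (0, y) -> 'D_(1, 0) F (0, y) = X c (chart_inv c y).
Proof.
case=> /= e0 cy Uy cphi; rewrite derive_slice_fst.
have [_ /(_ c cphi)] := phi_shifts e0 Uy.
rewrite (flow0 phi_group)// => H.
by rewrite -[RHS](@derive_val _ _ _ _ _ _ _ H).
Qed.

(** The function w(phi_t(p)) (d phi_t(v)) of t vanishes near t = 0 when v is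
tangent to the foliation at p.  Its derivative at t = 0 is the value on v of
the Lie derivative of w, provided that the time derivative of d phi_t(v) is
the derivative along v of the velocity X; this is the symmetry of the second
derivatives of the flow in time and space. *)
Lemma flow_lie_derivative (v : 'rV[R]_2) : pairing (w c p) v = 0 ->
  \sum_(j < 2)
    (w c p 0 j * 'D_v (fun y => X c (chart_inv c y) 0 j) u +
     v 0 j * 'D_(X c p) (fun y => w c (chart_inv c y) 0 j) u) = 0.
Proof.
move=> wv.
pose W j (y : 'rV[R]_2) := w c (chart_inv c y) 0 j.
have W_diff j : differentiable (W j) u.
  apply: differentiable_entry; apply: smooth_differentiable (w_smooth c) _.
  by apply: chart_coordinate_set => //; exact: UD.
pose Fj (j : 'I_2) z := F z 0 j.
have Fj_diff j : \forall z \near ((0 : R), u), differentiable (Fj j) z.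
  by apply: filterS F_diff => z; exact: differentiable_entry.
have Fj_diff2 j v' : differentiable ('D_v' (Fj j)) ((0 : R), u).
  exact: differentiable_derive_entry.
have F0u : F (0, u) = u by apply: F0; exact: nbhs_singleton near_S.
have Fu_diff := nbhs_singleton F_diff.
(* w(phi_t) (d phi_t(v)) as a function of the time and the starting point *)
pose Q z := \sum_(j < 2) W j (F z) * 'D_(0, v) (Fj j) z.
have WF_diff j : differentiable (W j \o F) ((0 : R), u).
  by apply: differentiable_comp => //; rewrite F0u.
have DQ : 'D_(1, 0) Q ((0 : R), u) = \sum_(j < 2)
    (w c p 0 j * 'D_v (fun y => X c (chart_inv c y) 0 j) u +
     v 0 j * 'D_(X c p) (fun y => w c (chart_inv c y) 0 j) u).
  have -> : Q = \sum_(j < 2) ((W j \o F) * 'D_(0, v) (Fj j)).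
    by apply/funext => z; rewrite /Q fct_sumE.
  rewrite derive_sum; last first.
    by move=> j; apply: derivableM; apply: diff_derivable.
  apply: eq_bigr => j _.
  rewrite deriveM; [|exact: diff_derivable|exact: diff_derivable].
  congr (_ * _ + _ * _).
  - by rewrite /= F0u /W /u chartK.
  - rewrite (derive_comm (Fj_diff j) (Fj_diff2 j (0, v)) (Fj_diff2 j (1, 0))).
    rewrite derive_slice_snd; apply: near_eq_derive.
    apply: filterS near_u => y Sy.
    rewrite derive_entry ?velocity//.
    exact: smooth_differentiable F_smooth Sy.
  - rewrite derive_slice_snd -[RHS](_ : 'D_v (fun y : 'rV[R]_2 => y 0 j) u = _).
      apply: near_eq_derive; apply: filterS near_u => y Sy.
      by rewrite /Fj F0.
    by rewrite derive_entry ?derive_id.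
  - rewrite deriveE// diff_comp ?F0u//= -!deriveE ?F0u//.
    by rewrite velocity ?chartK//; exact: nbhs_singleton near_S.
rewrite -DQ derive_slice_fst.
transitivity ('D_1 (cst (0 : R)) (0 : R)); last exact: derive_cst.
apply: near_eq_derive; apply: filterS near_0 => t St.
have [/= te _ _ cphi] := St; rewrite /u chartK// in cphi.
have dF := smooth_differentiable F_smooth St.
have := (phi_preserves te v Up cp cphi).1 wv.
have -> : tangent_map (phi t) c c p v = 'D_(0, v) F (t, u).
  by rewrite derive_slice_snd deriveE//; exact: differentiable_slice_snd.
move=> H; apply: etrans H; rewrite /Q /pairing; apply: eq_bigr => j _.
by rewrite /W /F/= /u !chartK// derive_entry.
Qed.

End FlowLieDerivative.

Section AutomorphismLieDerivative.
Context {R : realType} {M : smooth_surface R} (D : set M) (openD : open D).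
Context (w : 'I_3 -> components M) (X : components M).
Context (X_aut : infinitesimal_automorphism D w X) (c : chart_index M).

Lemma automorphism_lie_derivative i u :
  smooth_components D (w i) -> coordinate_set c D u ->
  coordinate c (w i) 0 u * lie_derivative c X (w i) 1 u -
  coordinate c (w i) 1 u * lie_derivative c X (w i) 0 u = 0.
Proof.
move=> w_smooth Ou; have [[X_smooth _] flow] := X_aut.
have [cu Du] := Ou; set p := chart_inv c u in Du.
have cp : chart_dom c p := chart_inv_in_dom cu.
have up : chart c p = u by exact: chart_invK.
have [U [eps [phi [[oU Up UD eps0] [group shifts web]]]]] := flow p Du.
(* the tangent vector of the foliation *)
pose v : 'rV[R]_2 := \row_l
  (if l == 0 then - coordinate c (w i) 1 u else coordinate c (w i) 0 u).
have wv : pairing (w i c p) v = 0.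
  by rewrite /pairing sum_ord2 !mxE/= mulrN mulrC addNr.
have := flow_lie_derivative oU UD eps0 w_smooth group shifts
  (fun t te => web t te i) Up cp wv.
rewrite up; have -> : X c p = \row_l coordinate c X l u.
  by apply/rowP => l; rewrite mxE.
rewrite -[LHS]/(\sum_(j < 2)
  (coordinate c (w i) j u * 'D_v (coordinate c X j) u +
   v 0 j * 'D_(\row_l coordinate c X l u) (coordinate c (w i) j) u)).
rewrite sum_ord2 !derive_partials; try exact: coordinate_differentiable.
by rewrite !mxE/= => H; rewrite -[RHS]H /lie_derivative; ring_at u.
Qed.

(** As the three forms add up to 0, [common_factor] applies to w_0 and w_1,
their sum being - w_2. *)
Lemma web_lie_derivative u : web3 D w -> coordinate_set c D u ->
  coordinate c (w 0) 0 u * coordinate c (w 1) 1 u -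
  coordinate c (w 0) 1 u * coordinate c (w 1) 0 u != 0 ->
  exists g, forall l,
    lie_derivative c X (w 0) l u = g * coordinate c (w 0) l u /\
    lie_derivative c X (w 1) l u = g * coordinate c (w 1) l u.
Proof.
move=> [w_form _ w_sum] Ou.
have w_smooth i : smooth_components D (w i) by have [] := w_form i.
have wL i := automorphism_lie_derivative (w_smooth i) Ou.
move=> /(@common_factor _ (fun l => coordinate c (w 0) l u)
  (fun l => coordinate c (w 1) l u) (fun l => lie_derivative c X (w 0) l u)
  (fun l => lie_derivative c X (w 1) l u)); apply=> //.
have w2E l v : coordinate_set c D v ->
    coordinate c (w 2) l v =
    - (coordinate c (w 0) l v + coordinate c (w 1) l v).
  move=> [cv Dv]; have := w_sum c _ Dv (chart_inv_in_dom cv).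
  rewrite !big_ord_recl big_ord0 addr0 => /(congr1 (fun N : 'rV[R]_2 => N 0 l)).
  rewrite !mxE /coordinate (_ : lift _ (lift _ _) = 2); last exact: val_inj.
  rewrite (_ : lift _ _ = 1); last exact: val_inj.
  by rewrite addrA => /eqP; rewrite addrC addr_eq0 => /eqP.
have dw i l := coordinate_differentiable (c := c) l (w_smooth i) Ou.
have dw2 j l : partial j (coordinate c (w 2) l) u =
    - (partial j (coordinate c (w 0) l) u + partial j (coordinate c (w 1) l) u).
  rewrite (partial_eq_on (open_coordinate_set openD) j (w2E l) Ou).
  by rewrite partialN ?partialD//; exact: differentiableD (dw 0 l) (dw 1 l).
have L2 l : lie_derivative c X (w 2) l u =
    - (lie_derivative c X (w 0) l u + lie_derivative c X (w 1) l u).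
  by rewrite /lie_derivative !dw2 !w2E//; ring_at u.
by have := wL 2; rewrite !L2 !w2E// !mulrNN.
Qed.

End AutomorphismLieDerivative.

(** * Infinitesimal symmetries of a coframe of nonzero curvature *)

(** The coframe theta_i, i = 0, 1, has the components [th i l] in the
coordinates of the plane, and the dual frame has the components [nb i l]; the
connection form is [al], and d th_i = th_i /\ al, d al = th_0 /\ th_1.  The
last hypothesis says that the Lie derivative along X multiplies both forms by
the same number h at each point.  That h is differentiable as a function of the
point comes from the formula defining [m] below. *)
Section CoframeSymmetry.
Context {R : realType} (O : set 'rV[R]_2) (openO : open O).
Context (th nb : 'I_2 -> 'I_2 -> 'rV[R]_2 -> R).
Context (al X a : 'I_2 -> 'rV[R]_2 -> R).
Context (th_diff : forall i l, differentiable_on O (th i l))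
  (th_diff2 : forall i l j, differentiable_on O (partial j (th i l)))
  (X_diff : forall l, differentiable_on O (X l))
  (X_diff2 : forall l j, differentiable_on O (partial j (X l)))
  (nb_diff : forall i l, differentiable_on O (nb i l))
  (al_diff : forall l, differentiable_on O (al l))
  (a_diff : forall i, differentiable_on O (a i)).
Context (dual : forall i j u, O u ->
  th i 0 u * nb j 0 u + th i 1 u * nb j 1 u = (i == j)%:R).
Context (dth : forall i u, O u ->
  partial 0 (th i 1) u - partial 1 (th i 0) u =
  th i 0 u * al 1 u - th i 1 u * al 0 u).
Context (dal : forall u, O u -> partial 0 (al 1) u - partial 1 (al 0) u =
  th 0 0 u * th 1 1 u - th 0 1 u * th 1 0 u).
Context (alE : forall l u, O u -> al l u = a 0 u * th 0 l u + a 1 u * th 1 l u).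
Context (lie : forall u, O u -> exists h, forall i l,
  X 0 u * partial 0 (th i l) u + X 1 u * partial 1 (th i l) u +
  (th i 0 u * partial l (X 0) u + th i 1 u * partial l (X 1) u) = h * th i l u).

Let x i u := th i 0 u * X 0 u + th i 1 u * X 1 u.

Let dx i l u := th i 0 u * partial l (X 0) u + X 0 u * partial l (th i 0) u +
  (th i 1 u * partial l (X 1) u + X 1 u * partial l (th i 1) u).

(** The value of the form d x_0 + x_0 al on the first vector of the dual frame;
it equals h + al(X) because that form is (h + al(X)) th_0. *)
Let m u := dx 0 0 u * nb 0 0 u + dx 0 1 u * nb 0 1 u +
  x 0 u * (al 0 u * nb 0 0 u + al 1 u * nb 0 1 u).

Let x_diff i : differentiable_on O (x i).
Proof. by rewrite /x; differentiate. Qed.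

Let m_diff : differentiable_on O m.
Proof. by rewrite /m /dx; differentiate. Qed.

Let partial_xE i l u : O u -> partial l (x i) u = dx i l u.
Proof.
move=> Ou; rewrite /x partialD ?partialM//.
all: try solve [exact: th_diff|exact: X_diff].
- by apply: differentiableM; [exact: th_diff|exact: X_diff].
- by apply: differentiableM; [exact: th_diff|exact: X_diff].
Qed.

(** Cartan's formula for the Lie derivative of theta_i. *)
Let partial_x i l u : O u ->
  partial l (x i) u = m u * th i l u - x i u * al l u.
Proof.
move=> Ou; rewrite partial_xE//; have [h hE] := lie Ou.
have dxE i' l' : dx i' l' u =
    (h + (al 0 u * X 0 u + al 1 u * X 1 u)) * th i' l' u - x i' u * al l' u.
  have E : dx i' l' u = h * th i' l' u +
     (X 0 u * (partial l' (th i' 0) u - partial 0 (th i' l') u) +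
      X 1 u * (partial l' (th i' 1) u - partial 1 (th i' l') u)).
    by rewrite -hE /dx; ring_at u.
  have D := dth i' Ou; rewrite E /x; elim/ord2_ind: l' {E}.
  - by rewrite subrr D; ring_at u.
  - by rewrite subrr -opprB D; ring_at u.
have -> : m u = h + (al 0 u * X 0 u + al 1 u * X 1 u).
  rewrite /m !dxE; have E : th 0 0 u * nb 0 0 u + th 0 1 u * nb 0 1 u = 1.
    by rewrite dual.
  by rewrite -[RHS]mulr1 -[X in _ = _ * X]E /x; ring_at u.
by rewrite dxE.
Qed.

Let area u := th 0 0 u * th 1 1 u - th 0 1 u * th 1 0 u.

Let area_neq0 u : O u -> area u != 0.
Proof.
move=> Ou; apply: (dual_frame_area (th := fun i l => th i l u)
  (nb := fun i l => nb i l u)) => i j; exact: dual.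
Qed.

(** The vanishing of the exterior derivatives of both d x_i. *)
Let partial_m l u : O u -> partial l m u = x 1 u * th 0 l u - x 0 u * th 1 l u.
Proof.
move=> Ou.
have H i : partial 0 m u * th i 1 u - partial 1 m u * th i 0 u = x i u * area u.
  pose F j u := m u * th i j u - x i u * al j u.
  have F_diff j : differentiable_on O (F j) by rewrite /F; differentiate.
  have FE j k : partial j (F k) u =
      m u * partial j (th i k) u + th i k u * partial j m u -
      (x i u * partial j (al k) u + al k u * (m u * th i j u - x i u * al j u)).
    rewrite partialB ?partialM ?partial_x//.
    all: try solve [exact: m_diff|exact: x_diff|exact: th_diff|exact: al_diff].
    - by apply: (differentiable_onM m_diff (@th_diff i k)).
    - by apply: (differentiable_onM (@x_diff i) (@al_diff k)).
  have E := closed_differential openO (x_diff i) F_diff (partial_x i) Ou.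
  rewrite !FE in E.
  rewrite /area -dal//.
  transitivity ((m u * partial 0 (th i 1) u + th i 1 u * partial 0 m u) -
    (m u * partial 1 (th i 0) u + th i 0 u * partial 1 m u) -
    m u * (partial 0 (th i 1) u - partial 1 (th i 0) u)); first by ring_at u.
  rewrite dth//; move: E => /eqP; rewrite -subr_eq0 => /eqP E.
  by apply/eqP; rewrite -subr_eq0 -E; apply/eqP; ring_at u.
apply: (mulIf (area_neq0 Ou)).
transitivity (th 0 l u * (x 1 u * area u) - th 1 l u * (x 0 u * area u)).
  by rewrite -!H /area; elim/ord2_ind: l; ring_at u.
by ring_at u.
Qed.

(** The vanishing of the exterior derivative of d m; it is here that the
curvature forces h = 0. *)
Let mE u : O u -> m u = a 0 u * x 0 u + a 1 u * x 1 u.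
Proof.
move=> Ou.
pose F l u := x 1 u * th 0 l u - x 0 u * th 1 l u.
have F_diff l : differentiable_on O (F l) by rewrite /F; differentiate.
have := closed_differential openO m_diff F_diff partial_m Ou.
have FE j l : partial j (F l) u =
  x 1 u * partial j (th 0 l) u + th 0 l u * (m u * th 1 j u - x 1 u * al j u) -
  (x 0 u * partial j (th 1 l) u + th 1 l u * (m u * th 0 j u - x 0 u * al j u)).
  rewrite partialB ?partialM ?partial_x//.
  all: try solve [exact: x_diff|exact: th_diff].
  - by apply: (differentiable_onM (@x_diff 1) (@th_diff 0 l)).
  - by apply: (differentiable_onM (@x_diff 0) (@th_diff 1 l)).
rewrite !FE => /eqP; rewrite -subr_eq0 => /eqP E.
have D i : partial 0 (th i 1) u =
    partial 1 (th i 0) u + (th i 0 u * al 1 u - th i 1 u * al 0 u).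
  by rewrite -dth// addrC subrK.
rewrite !D in E.
have E2 : x 1 u * (th 0 0 u * al 1 u - th 0 1 u * al 0 u) -
    x 0 u * (th 1 0 u * al 1 u - th 1 1 u * al 0 u) = m u * area u.
  apply: (mulfI (_ : 2 != 0 :> R)); first by rewrite pnatr_eq0.
  by apply/eqP; rewrite -subr_eq0 -[X in _ == X]E /area; apply/eqP; ring_at u.
by apply: (mulIf (area_neq0 Ou)); rewrite -E2 !alE// /area; ring_at u.
Qed.

Lemma symmetry_fixes_invariants i u : O u ->
  X 0 u * partial 0 (a i) u + X 1 u * partial 1 (a i) u = 0.
Proof.
move=> Ou.
have dm l : x 0 u * partial l (a 0) u + x 1 u * partial l (a 1) u =
    x 1 u * th 0 l u - x 0 u * th 1 l u.
  have := partial_m l Ou; rewrite (partial_eq_on openO l mE)// => <-.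
  rewrite partialD ?partialM ?partial_x//.
  all: try solve [exact: x_diff|exact: a_diff].
  - by rewrite !mE// !alE//; ring_at u.
  - by apply: (differentiable_onM (@a_diff 0) (@x_diff 0)).
  - by apply: (differentiable_onM (@a_diff 1) (@x_diff 1)).
have dal_a :
    partial 0 (a 0) u * th 0 1 u - partial 1 (a 0) u * th 0 0 u +
    (partial 0 (a 1) u * th 1 1 u - partial 1 (a 1) u * th 1 0 u) = area u.
  rewrite /area -dal//.
  rewrite (partial_eq_on openO 0 (alE 1))// (partial_eq_on openO 1 (alE 0))//.
  rewrite !partialD ?partialM//.
  all: try solve [exact: th_diff|exact: a_diff].
  all: try by apply: (differentiable_onM (@a_diff _) (@th_diff _ _)).
  have D k : partial 0 (th k 1) u =
      partial 1 (th k 0) u + (th k 0 u * al 1 u - th k 1 u * al 0 u).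
    by rewrite -dth// addrC subrK.
  by rewrite !D !alE//; ring_at u.
pose Xa k := X 0 u * partial 0 (a k) u + X 1 u * partial 1 (a k) u.
(* the interior product of X with d al, added to d m *)
have Xa_th l : Xa 0 * th 0 l u + Xa 1 * th 1 l u = 0.
  elim/ord2_ind: l.
  - transitivity (x 0 u * partial 0 (a 0) u + x 1 u * partial 0 (a 1) u -
      X 1 u * (partial 0 (a 0) u * th 0 1 u - partial 1 (a 0) u * th 0 0 u +
        (partial 0 (a 1) u * th 1 1 u - partial 1 (a 1) u * th 1 0 u))).
      by rewrite /Xa /x; ring_at u.
    by rewrite dm dal_a /x /area; ring_at u.
  - transitivity (x 0 u * partial 1 (a 0) u + x 1 u * partial 1 (a 1) u +
      X 0 u * (partial 0 (a 0) u * th 0 1 u - partial 1 (a 0) u * th 0 0 u +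
        (partial 0 (a 1) u * th 1 1 u - partial 1 (a 1) u * th 1 0 u))).
      by rewrite /Xa /x; ring_at u.
    by rewrite dm dal_a /x /area; ring_at u.
have Xa_area k : Xa k * area u = 0.
  elim/ord2_ind: k.
  - transitivity ((Xa 0 * th 0 0 u + Xa 1 * th 1 0 u) * th 1 1 u -
                  (Xa 0 * th 0 1 u + Xa 1 * th 1 1 u) * th 1 0 u).
      by rewrite /area; ring_at u.
    by rewrite !Xa_th !mul0r subrr.
  - transitivity ((Xa 0 * th 0 1 u + Xa 1 * th 1 1 u) * th 0 0 u -
                  (Xa 0 * th 0 0 u + Xa 1 * th 1 0 u) * th 0 1 u).
      by rewrite /area; ring_at u.
    by rewrite !Xa_th !mul0r subrr.
by apply: (mulIf (area_neq0 Ou)); rewrite Xa_area mul0r.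
Qed.

End CoframeSymmetry.

(** * The normalized coframe of a web with nonvanishing curvature *)

Section NormalizedCoframe.
Context {R : realType} {M : smooth_surface R} (D : set M) (openD : open D).
Context (w : 'I_3 -> components M) (w_web : web3 D w).
Context (gamma : components M) (gamma_connection : web_connection D w gamma).
Context (K : M -> R) (K_curvature : web_curvature D w gamma K).
Context (e : bool) (k : M -> R) (k_smooth : smooth_function D k).
Context (k_gt0 : forall p, D p -> 0 < k p).
Context (K_sqr : forall p, D p -> (-1) ^+ e * K p = k p ^+ 2).
Context (nabla : 'I_2 -> components M).
Context (nabla_dual :
  dual_frame D (scaled_coframe k (oriented_coframe e w)) nabla).
Context (a : 'I_2 -> M -> R).
Context (a_def : absolute_invariants D (scaled_coframe k (oriented_coframe e w))
  (normalized_connection k gamma) a).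
Context (c : chart_index M).

Let O : set 'rV[R]_2 := coordinate_set c D.
Let kf (u : 'rV[R]_2) : R := k (chart_inv c u).
Let om (i l : 'I_2) := coordinate c (oriented_coframe e w i) l.
Let th (i l : 'I_2) (u : 'rV[R]_2) : R := kf u * om i l u.
Let gm (l : 'I_2) := coordinate c gamma l.
Let al (l : 'I_2) (u : 'rV[R]_2) : R := gm l u - (kf u)^-1 * partial l kf u.
Let nb (i l : 'I_2) := coordinate c (nabla i) l.
Let af (i : 'I_2) (u : 'rV[R]_2) : R := a i (chart_inv c u).

Let openO : open O. Proof. exact: open_coordinate_set. Qed.

Let w_smooth i : smooth_components D (w i).
Proof. by have [w_form _ _] := w_web; have [] := w_form i. Qed.

Let om_smooth i : smooth_components D (oriented_coframe e w i).
Proof. by rewrite /oriented_coframe; case: ifP. Qed.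

Let kf_neq0 u : O u -> kf u != 0.
Proof. by move=> [_ Du]; rewrite gt_eqF// k_gt0. Qed.

Let dk_smooth j : smooth O (partial j kf).
Proof. exact: smooth_derive (k_smooth c). Qed.

Let k_diff : differentiable_on O kf.
Proof. by move=> u; exact: smooth_differentiable (k_smooth c). Qed.

Let dk_diff j : differentiable_on O (partial j kf).
Proof. by move=> u; exact: smooth_differentiable (dk_smooth j). Qed.

Let kV_diff : differentiable_on O (fun u => (kf u)^-1).
Proof. exact: differentiable_onV. Qed.

Let om_diff i l : differentiable_on O (om i l).
Proof. exact: coordinate_differentiable. Qed.

Let om_diff2 i l j : differentiable_on O (partial j (om i l)).
Proof. exact: coordinate_differentiable2. Qed.

Let th_diff i l : differentiable_on O (th i l).
Proof. by rewrite /th; differentiate. Qed.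

Let partial_th i l j u : O u ->
  partial j (th i l) u =
  kf u * partial j (om i l) u + om i l u * partial j kf u.
Proof. by move=> Ou; rewrite partialM//; [exact: k_diff|exact: om_diff]. Qed.

Let th_diff2 i l j : differentiable_on O (partial j (th i l)).
Proof.
apply: (@differentiable_on_eq _ O openO
  (fun u => kf u * partial j (om i l) u + om i l u * partial j kf u)).
  by move=> u Ou; rewrite partial_th.
by differentiate.
Qed.

Let gm_diff l : differentiable_on O (gm l).
Proof.
have [[gamma_smooth _] _] := gamma_connection.
exact: coordinate_differentiable.
Qed.

Let al_diff l : differentiable_on O (al l).
Proof. by rewrite /al; differentiate. Qed.

Let nb_diff i l : differentiable_on O (nb i l).
Proof.
apply: coordinate_differentiable; have [nabla_field _] := nabla_dual.
by have [] := nabla_field i.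
Qed.

Let thE i l u :
  coordinate c (scaled_coframe k (oriented_coframe e w) i) l u = th i l u.
Proof. by rewrite /coordinate /scaled_coframe mxE. Qed.

Let dual i j u : O u -> th i 0 u * nb j 0 u + th i 1 u * nb j 1 u = (i == j)%:R.
Proof.
move=> [cu Du]; have [_ nablaE] := nabla_dual.
by rewrite -(nablaE _ _ i j Du (chart_inv_in_dom cu)) /pairing sum_ord2 -!thE.
Qed.

Let area_neq0 u : O u -> th 0 0 u * th 1 1 u - th 0 1 u * th 1 0 u != 0.
Proof.
move=> Ou; apply: (dual_frame_area (th := fun i l => th i l u)
  (nb := fun i l => nb i l u)) => i j; exact: dual.
Qed.

Let dom i u : O u -> partial 0 (om i 1) u - partial 1 (om i 0) u =
  om i 0 u * gm 1 u - om i 1 u * gm 0 u.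
Proof.
move=> [cu Du]; have [_ gammaE] := gamma_connection.
have := gammaE c (chart_inv c u) Du (chart_inv_in_dom cu).
rewrite /exterior_derivative /wedge_product chart_invK// => -[w0 w1].
by rewrite /om /oriented_coframe; case: ifP => _; [exact: w0|exact: w1].
Qed.

(** The correction d k / k of the connection form compensates for the
derivative of the factor k. *)
Let dth i u : O u -> partial 0 (th i 1) u - partial 1 (th i 0) u =
  th i 0 u * al 1 u - th i 1 u * al 0 u.
Proof.
move=> Ou; rewrite !partial_th//.
transitivity (kf u * (partial 0 (om i 1) u - partial 1 (om i 0) u) +
    (om i 1 u * partial 0 kf u - om i 0 u * partial 1 kf u)).
  by ring_at u.
by rewrite dom// /th /al; have := kf_neq0 Ou; abstract_values u => k0; field.
Qed.

(** The coframe is reoriented when K < 0, so that k^2 times the oriented area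
form of the web is K times its area form, i.e. d gamma. *)
Let th_area u : O u -> th 0 0 u * th 1 1 u - th 0 1 u * th 1 0 u =
  K (chart_inv c u) * wedge_product (w 0) (w 1) c (chart_inv c u).
Proof.
move=> [cu Du]; transitivity (kf u ^+ 2 * ((-1) ^+ e *
    wedge_product (w 0) (w 1) c (chart_inv c u))).
  rewrite /wedge_product -[RHS](oriented_area e (kf u)
    (fun l => w 0 c (chart_inv c u) 0 l) (fun l => w 1 c (chart_inv c u) 0 l)).
  by rewrite /th /om /oriented_coframe /coordinate; case: (e).
by rewrite /kf -(K_sqr Du) mulrACA -expr2 sqrr_sign mul1r.
Qed.

(** d k / k is closed. *)
Let dal u : O u -> partial 0 (al 1) u - partial 1 (al 0) u =
  th 0 0 u * th 1 1 u - th 0 1 u * th 1 0 u.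
Proof.
move=> Ou; have [cu Du] := Ou; rewrite th_area// -K_curvature//; last first.
  exact: chart_inv_in_dom.
rewrite /exterior_derivative chart_invK//.
rewrite -[RHS]/(partial 0 (gm 1) u - partial 1 (gm 0) u).
have sym : partial 0 (partial 1 kf) u = partial 1 (partial 0 kf) u.
  exact: (closed_differential openO k_diff dk_diff).
have E j l : partial j (al l) u = partial j (gm l) u -
    ((kf u)^-1 * partial j (partial l kf) u -
     partial l kf u * ((kf u) ^- 2 * partial j kf u)).
  have dq : differentiable (fun u => (kf u)^-1 * partial l kf u) u.
    exact: differentiableM (kV_diff Ou) (dk_diff l Ou).
  rewrite (partialB j (gm_diff l Ou) dq).
  rewrite (partialM j (kV_diff Ou) (dk_diff l Ou)).
  by rewrite (partialV j (kf_neq0 Ou) (k_diff Ou)) mulNr mulrN.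
rewrite !E sym; move: (_ ^- 2) (_ ^-1) => *; ring_at u.
Qed.

Let alE l u : O u -> al l u = af 0 u * th 0 l u + af 1 u * th 1 l u.
Proof.
move=> [cu Du]; have cp := chart_inv_in_dom cu.
have := congr1 (fun N : 'rV[R]_2 => N 0 l) (a_def Du cp).
by rewrite sum_ord2 /normalized_connection /differential !mxE chart_invK.
Qed.

Let af_diff i : differentiable_on O (af i).
Proof.
apply: (@differentiable_on_eq _ O openO
  (fun u => al 0 u * nb i 0 u + al 1 u * nb i 1 u)); last by differentiate.
move=> u Ou; rewrite !alE//.
transitivity (af 0 u * (th 0 0 u * nb i 0 u + th 0 1 u * nb i 1 u) +
              af 1 u * (th 1 0 u * nb i 0 u + th 1 1 u * nb i 1 u)).
  by ring_at u.
by rewrite !dual//; elim/ord2_ind: i; rewrite /= mulr1 mulr0 ?addr0 ?add0r.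
Qed.

Section Automorphism.
Context (X : components M) (X_aut : infinitesimal_automorphism D w X).

Let X_smooth : smooth_components D X.
Proof. by have [[]] := X_aut. Qed.

(** Rescaling the forms by k adds X(k) / k to the factor. *)
Let lie_th u : O u -> exists h, forall i l,
  coordinate c X 0 u * partial 0 (th i l) u +
  coordinate c X 1 u * partial 1 (th i l) u +
  (th i 0 u * partial l (coordinate c X 0) u +
   th i 1 u * partial l (coordinate c X 1) u) = h * th i l u.
Proof.
move=> Ou; have [|g gE] := web_lie_derivative openD X_aut w_web Ou.
  by have := area_neq0 Ou; rewrite th_area// mulf_eq0 negb_or => /andP[_].
have omE i l : lie_derivative c X (oriented_coframe e w i) l u = g * om i l u.
  by have [E0 E1] := gE l; rewrite /om /oriented_coframe; case: ifP.
pose Xk :=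
  coordinate c X 0 u * partial 0 kf u + coordinate c X 1 u * partial 1 kf u.
exists (g + Xk / kf u) => i l; rewrite !partial_th//.
transitivity (kf u * lie_derivative c X (oriented_coframe e w i) l u +
              om i l u * Xk).
  by rewrite /lie_derivative -/(om i l) /th /Xk /om; ring_at u.
by rewrite omE /th; field; exact: kf_neq0.
Qed.

Lemma automorphism_fixes_invariants i u : O u ->
  coordinate c X 0 u * partial 0 (af i) u +
  coordinate c X 1 u * partial 1 (af i) u = 0.
Proof.
apply: (symmetry_fixes_invariants openO th_diff th_diff2 _ _ nb_diff al_diff
  af_diff dual dth dal alE lie_th).
- by move=> l; exact: coordinate_differentiable.
- by move=> l j; exact: coordinate_differentiable2.
Qed.

Lemma automorphism_vanishes p : D p -> chart_dom c p ->
  invariant_J nabla a c p != 0 -> X c p = 0.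
Proof.
move=> Dp cp; have Ou := chart_coordinate_set cp Dp.
have vE i j : vderive (nabla i) (a j) c p =
    nabla i c p 0 0 * partial 0 (af j) (chart c p) +
    nabla i c p 0 1 * partial 1 (af j) (chart c p).
  by rewrite -derive_partials//; exact: af_diff.
rewrite /invariant_J det_plane !mxE !vE => J0.
have := automorphism_fixes_invariants 1 Ou.
have := automorphism_fixes_invariants 0 Ou.
rewrite /coordinate !chartK// => Xa0 Xa1.
have [X0 X1] := kernel_of_regular_product J0 Xa0 Xa1.
by apply/rowP => l; rewrite mxE; elim/ord2_ind: l.
Qed.

End Automorphism.

End NormalizedCoframe.

(** * The zero field *)

Section ZeroField.
Context {R : realType} {M : smooth_surface R} (D : set M) (openD : open D).

Lemma smooth_map_id U : smooth_map U (fun p : M => p).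
Proof.
split=> [p _|c c']; first exact: cvg_id.
by apply: smooth_subset (@chart_transition _ _ c c') => u [cu [_ c'u]].
Qed.

Lemma constant_flow_group : local_one_parameter_group D 1 (fun _ p => p).
Proof.
split=> //.
- by move=> t p _ _; exact: cvg_snd.
- move=> c c' n; apply: Ck_comp_snd (@chart_transition _ _ c c' n).
  by move=> z [_ cz _ c'z]; split.
- move=> t _; split; [by rewrite image_id|exact: smooth_map_id|].
  by exists (fun p => p) => //; exact: smooth_map_id.
Qed.

Lemma zero_infinitesimal_automorphism (w : 'I_3 -> components M) X :
  (forall i, one_form D (w i)) -> vector_field D X -> zero_on D X ->
  infinitesimal_automorphism D w X.
Proof.
move=> w_form X_field X0; split=> // p0 Dp0; exists D, 1, (fun _ p => p).
split; split=> //; first exact: constant_flow_group.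
- by move=> t p _ Dp; split=> // c cp; rewrite X0//; exact: is_derive_cst.
- move=> t _ i c c' p v Dp cp c'p; have [_ wE] := w_form i.
  by rewrite (wE c c' p v Dp cp c'p).
Qed.

End ZeroField.

(** * The theorem *)

Theorem theorem5p3 (R : realType) (M : smooth_surface R) (D : set M)
    (D_domain : domain D)
    (w : 'I_3 -> components M) (w_web : web3 D w)
    (gamma : components M) (gamma_connection : web_connection D w gamma)
    (K : M -> R) (K_curvature : web_curvature D w gamma K)
    (K_neq0 : forall p, D p -> K p != 0)
    (e : bool) (k : M -> R) (k_smooth : smooth_function D k)
    (k_gt0 : forall p, D p -> 0 < k p)
    (K_sqr : forall p, D p -> (-1) ^+ e * K p = k p ^+ 2)
    (theta : 'I_2 -> components M)
    (theta_def : theta = scaled_coframe k (oriented_coframe e w))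
    (alpha : components M) (alpha_def : alpha = normalized_connection k gamma)
    (nabla : 'I_2 -> components M) (nabla_dual : dual_frame D theta nabla)
    (a : 'I_2 -> M -> R) (a_def : absolute_invariants D theta alpha a)
    (J_neq0 : forall c p, D p -> chart_dom c p -> invariant_J nabla a c p != 0) :
  infinitesimally_rigid D w.
Proof.
have [openD _] := D_domain; have [w_form _ _] := w_web.
rewrite theta_def in nabla_dual a_def; rewrite alpha_def in a_def.
move=> X X_field; split=> [X_aut c p Dp cp|].
  exact: (automorphism_vanishes openD w_web gamma_connection K_curvature
    k_smooth k_gt0 K_sqr nabla_dual a_def X_aut Dp cp (J_neq0 c p Dp cp)).
exact: zero_infinitesimal_automorphism.
Qed.
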